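(* Let $q$ be complex with $|q|<1$ and define $$V_1(q)=q^{3}\frac{\mathfrak f(-q,-q^{27})}{\mathfrak f(-q^{13},-q^{15})},\quad V_2(q)=q^{2}\frac{\mathfrak f(-q^3,-q^{25})}{\mathfrak f(-q^{11},-q^{17})},\quad V_3(q)=q\frac{\mathfrak f(-q^5,-q^{23})}{\mathfrak f(-q^{9},-q^{19})}.$$ Then for every positive integer $n$: (i) $V_1^n(q)V_1^n(-q)=V_1^n(q^2)$ if $n\equiv0\pmod 2$ and $V_1^n(q)V_1^n(-q)=-V_1^n(q^2)$ if $n\equiv1\pmod2$; (ii) $V_2^n(q)V_2^n(-q)=V_2^n(q^2)$; (iii) $V_3^n(q)V_3^n(-q)=V_3^n(q^2)$ if $n\equiv0\pmod 2$ and $V_3^n(q)V_3^n(-q)=-V_3^n(q^2)$ if $n\equiv1\pmod2$.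
   Context: Ramanujan's general theta function is $\mathfrak f(a,b)=\sum_{t=-\infty}^{\infty}a^{t(t+1)/2}b^{t(t-1)/2}$ for $|ab|<1$; equivalently $\mathfrak f(a,b)=(-a;ab)_\infty(-b;ab)_\infty(ab;ab)_\infty$ where $(\lambda;q)_\infty=\prod_{t\ge0}(1-\lambda q^t)$. *)

(* Defs.v *)
From Stdlib Require Import Reals ZArith.
From Coquelicot Require Import Coquelicot.

Open Scope C_scope.

(* Coquelicot's [Series] is real-valued; [iota P] is the unique element
   satisfying [P] when there is one. *)
Definition CSeries (u : nat -> C) : C :=
  iota (fun l : C_CompleteNormedModule => is_series u l).

Lemma CSeries_unique (u : nat -> C) (l : C) : is_series u l -> CSeries u = l.
Proof.
intros H.
assert (U : forall l' : C, is_series u l' -> l' = l).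
{ intros l' H'. exact (filterlim_locally_unique _ l' l H' H). }
apply U. apply (iota_correct (fun l : C_CompleteNormedModule => is_series u l)).
exists l. split; [exact H | intros l' H'; symmetry; exact (U l' H')].
Qed.

Definition CSeriesZ (u : Z -> C) : C :=
  CSeries (fun n => u (Z.of_nat n)) + CSeries (fun n => u (- Z.of_nat (S n))%Z).

(* Both exponents are nonnegative integers for every t in Z, so [Z.to_nat]
   and the division by 2 lose nothing. *)
Definition theta (a b : C) : C :=
  CSeriesZ (fun t => a ^ Z.to_nat (t * (t + 1) / 2) * b ^ Z.to_nat (t * (t - 1) / 2)).

Definition V1 (q : C) : C := q ^ 3 * (theta (- q) (- q ^ 27) / theta (- q ^ 13) (- q ^ 15)).
Definition V2 (q : C) : C := q ^ 2 * (theta (- q ^ 3) (- q ^ 25) / theta (- q ^ 11) (- q ^ 17)).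
Definition V3 (q : C) : C := q * (theta (- q ^ 5) (- q ^ 23) / theta (- q ^ 9) (- q ^ 19)).

(* Main.v *)
(** Write [phi x] for [theta x x]. In the double series of
    [theta a b * theta (-a) (-b)] the terms with [m + n] odd cancel under the swap
    of [m] and [n], and putting [m = r + s], [n = r - s] in the others gives
    [theta a b * theta (-a) (-b) = theta (-a^2) (-b^2) * phi (-ab)].
    The numerator and the denominator of each [V_i] have the same product
    [ab = q^28], so [phi (-q^28)] cancels in [V_i q * V_i (-q)], provided it is
    nonzero. The case [a = b = x] reads [phi x * phi (-x) = phi (-x^2) ^ 2]; hence
    a zero of [phi] at [-x] would give zeros at all [-x^(2^k)], contradicting
    [phi y -> 1] as [y -> 0]. *)

Require Import Defs.
From Stdlib Require Import Reals ZArith.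
From Stdlib Require Import List Permutation Lia Lra FinFun.
From Coquelicot Require Import Coquelicot.
Open Scope C_scope.

(** * Finite sums over lists, in abelian monoids so as to cover complex sums and real majorants *)

Definition lsum {G : AbelianMonoid} {A : Type} (f : A -> G) (l : list A) : G :=
  fold_right (fun x s => plus (f x) s) zero l.

Lemma lsum_cons {G : AbelianMonoid} {A : Type} (f : A -> G) (x : A) (l : list A) :
  lsum f (x :: l) = plus (f x) (lsum f l).
Proof. reflexivity. Qed.

Lemma lsum_app {G : AbelianMonoid} {A : Type} (f : A -> G) (l l' : list A) :
  lsum f (l ++ l') = plus (lsum f l) (lsum f l').
Proof.
induction l as [|x l IH]; cbn.
- now rewrite plus_zero_l.
- now rewrite <- plus_assoc; f_equal.
Qed.

Lemma lsum_map {G : AbelianMonoid} {A B : Type} (f : B -> G) (h : A -> B)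
    (l : list A) : lsum f (map h l) = lsum (fun x => f (h x)) l.
Proof. induction l as [|x l IH]; cbn; [reflexivity | now f_equal]. Qed.

Lemma lsum_ext_in {G : AbelianMonoid} {A : Type} (f g : A -> G) (l : list A) :
  (forall x, In x l -> f x = g x) -> lsum f l = lsum g l.
Proof.
induction l as [|x l IH]; intros H; cbn; [reflexivity|].
f_equal; [apply H; now left | apply IH; intros y Hy; apply H; now right].
Qed.

Lemma lsum_perm {G : AbelianMonoid} {A : Type} (f : A -> G) (l l' : list A) :
  Permutation l l' -> lsum f l = lsum f l'.
Proof.
induction 1 as [| x l l' _ IH | x y l | l1 l2 l3 _ IH1 _ IH2]; cbn.
- reflexivity.
- now f_equal.
- now rewrite !plus_assoc, (plus_comm (f y)).
- congruence.
Qed.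

Lemma lsum_prod {K : Ring} {A B : Type} (f : A -> K) (g : B -> K)
    (l : list A) (l' : list B) :
  lsum (fun p => mult (f (fst p)) (g (snd p))) (list_prod l l')
  = mult (lsum f l) (lsum g l').
Proof.
induction l as [|x l IH]; cbn [list_prod].
- symmetry. apply mult_zero_l.
- change (lsum f (x :: l)) with (plus (f x) (lsum f l)).
  rewrite lsum_app, mult_distr_r, IH, lsum_map. f_equal. cbn [fst snd].
  clear. induction l' as [|y l' IH]; cbn.
  + now rewrite mult_zero_r.
  + now rewrite mult_distr_l; f_equal.
Qed.

Lemma lsum_filter {G : AbelianMonoid} {A : Type} (p : A -> bool) (f : A -> G)
    (l : list A) :
  lsum f l = plus (lsum f (filter p l)) (lsum f (filter (fun x => negb (p x)) l)).
Proof.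
induction l as [|x l IH]; cbn [filter].
- symmetry. apply plus_zero_l.
- rewrite lsum_cons, IH. destruct (p x); cbn [negb]; rewrite lsum_cons.
  + now rewrite plus_assoc.
  + now rewrite !plus_assoc, (plus_comm (f x)).
Qed.

(** The filter keeps the complement of [l] in [l']. Since neither list has repetitions, [l] followed
    by this complement is a permutation of [l']. *)
Lemma lsum_sub {G : AbelianMonoid} {A : Type}
    (dec : forall x y : A, {x = y} + {x <> y}) (f : A -> G) (l l' : list A) :
  NoDup l -> NoDup l' -> incl l l' ->
  lsum f l' = plus (lsum f l)
    (lsum f (filter (fun x => if in_dec dec x l then false else true) l')).
Proof.
intros Hl Hl' Hi. rewrite <- lsum_app. apply lsum_perm, NoDup_Permutation.
- exact Hl'.
- apply NoDup_app; [exact Hl | now apply NoDup_filter |].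
  intros x Hx H. apply filter_In in H as [_ H].
  destruct (in_dec dec x l); [discriminate | contradiction].
- intros x. rewrite in_app_iff, filter_In. split.
  + intros Hx. destruct (in_dec dec x l); auto.
  + intros [Hx | [Hx _]]; [now apply Hi | exact Hx].
Qed.

Lemma Cmod_lsum {A : Type} (f : A -> C) (g : A -> R) (l : list A) :
  (forall x, Cmod (f x) <= g x)%R -> (Cmod (lsum f l) <= lsum g l)%R.
Proof.
intros H. induction l as [|x l IH].
- change (Cmod 0 <= 0)%R. rewrite Cmod_0. lra.
- change (Cmod (f x + lsum f l) <= g x + lsum g l)%R.
  eapply Rle_trans; [apply Cmod_triangle|]. specialize (H x). lra.
Qed.

Lemma lsum_nonneg {A : Type} (g : A -> R) (l : list A) :
  (forall x, 0 <= g x)%R -> (0 <= lsum g l)%R.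
Proof.
intros H. induction l as [|x l IH]; [apply Rle_refl|].
change (0 <= g x + lsum g l)%R. specialize (H x). lra.
Qed.

Lemma lsum_le_incl {A : Type} (dec : forall x y : A, {x = y} + {x <> y})
    (g : A -> R) (l l' : list A) :
  (forall x, 0 <= g x)%R -> NoDup l -> NoDup l' -> incl l l' ->
  (lsum g l <= lsum g l')%R.
Proof.
intros Hg Hl Hl' Hi. rewrite (lsum_sub dec g l l' Hl Hl' Hi).
change plus with Rplus.
match goal with |- (_ <= _ + ?s)%R => assert (0 <= s)%R by now apply lsum_nonneg end.
lra.
Qed.

Lemma lsum_opp {A : Type} (f : A -> C) (l : list A) :
  lsum (fun x => - f x) l = - lsum f l.
Proof.
induction l as [|x l IH].
- change (RtoC 0 = - 0). ring.
- change (- f x + lsum (fun x => - f x) l = - (f x + lsum f l)).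
  rewrite IH. ring.
Qed.

(** * Symmetric integer ranges and square boxes *)

Fixpoint zrange (N : nat) : list Z :=
  match N with
  | O => (0 :: nil)%Z
  | S N' => (Z.of_nat N :: - Z.of_nat N :: zrange N')%Z
  end.

Lemma in_zrange (N : nat) (t : Z) : In t (zrange N) <-> (Z.abs t <= Z.of_nat N)%Z.
Proof.
induction N as [|N IH].
- cbn. lia.
- cbn [zrange In]. rewrite IH. lia.
Qed.

Lemma NoDup_zrange (N : nat) : NoDup (zrange N).
Proof.
induction N as [|N IH].
- constructor; [easy | constructor].
- cbn [zrange]. constructor; [|constructor; [|exact IH]].
  + cbn [In]. rewrite in_zrange. lia.
  + rewrite in_zrange. lia.
Qed.

Lemma NoDup_list_prod {A B : Type} (l : list A) (l' : list B) :
  NoDup l -> NoDup l' -> NoDup (list_prod l l').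
Proof.
intros Hl Hl'. induction Hl as [|x l Hx Hl IH]; cbn; [constructor|].
apply NoDup_app; [| exact IH |].
- apply Injective_map_NoDup; [| exact Hl']. intros y y' E. congruence.
- intros [u v] H1 H2. apply in_map_iff in H1 as [y [E _]].
  apply in_prod_iff in H2 as [H2 _]. congruence.
Qed.

Definition box (N : nat) : list (Z * Z) := list_prod (zrange N) (zrange N).

Lemma in_box (N : nat) (m n : Z) :
  In (m, n) (box N) <-> (Z.abs m <= Z.of_nat N /\ Z.abs n <= Z.of_nat N)%Z.
Proof. unfold box. now rewrite in_prod_iff, !in_zrange. Qed.

Lemma NoDup_box (N : nat) : NoDup (box N).
Proof. apply NoDup_list_prod; apply NoDup_zrange. Qed.

Definition Zpair_dec (p p' : Z * Z) : {p = p'} + {p <> p'}.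
Proof. decide equality; apply Z.eq_dec. Defined.

(** * Rotation of a box *)

Definition rotate (p : Z * Z) : Z * Z := (fst p + snd p, fst p - snd p)%Z.

(* The terms with m + n odd cancel in pairs under (m, n) <-> (n, m); the even
   part of box (2N) contains rotate (box N), and what is left over avoids
   box N. *)
Lemma lsum_box_rotate (w : Z * Z -> C) (g : Z -> R) (N : nat) :
  (forall t, 0 <= g t)%R ->
  (forall p, Cmod (w p) <= g (fst p) * g (snd p))%R ->
  (forall m n, Z.even (m + n) = false -> w (n, m) = - w (m, n)) ->
  (Cmod (lsum w (box (2 * N)) - lsum (fun p => w (rotate p)) (box N))
   <= lsum g (zrange (2 * N)) * lsum g (zrange (2 * N))
      - lsum g (zrange N) * lsum g (zrange N))%R.
Proof.
intros Hg Hw Hodd.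
set (ev := fun p : Z * Z => Z.even (fst p + snd p)).
set (E := filter ev (box (2 * N))).
set (D := map rotate (box N)).
assert (HO : lsum w (filter (fun p => negb (ev p)) (box (2 * N))) = RtoC 0).
{ set (O := filter _ _).
  set (swap := fun p : Z * Z => (snd p, fst p)).
  (* The swap permutes the odd part and negates each term, so the sum equals its own negative. *)
  assert (HP : lsum w O = - lsum w O).
  { rewrite <- lsum_opp at 1.
    transitivity (lsum w (map swap O)).
    - apply lsum_perm. symmetry. apply Permutation_map_same_l.
      + apply Injective_map_NoDup; [| apply NoDup_filter, NoDup_box].
        intros [a b] [c d] H. unfold swap in H. cbn in H. congruence.
      + intros p Hp. apply in_map_iff in Hp as [[a b] [<- Hab]].
        apply filter_In in Hab as [H1 H2]. apply filter_In.
        unfold swap, ev in *. cbn [fst snd] in *.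
        rewrite in_box in *. rewrite Z.add_comm. tauto.
    - rewrite lsum_map. apply lsum_ext_in. intros [a b] Hab.
      apply filter_In in Hab as [_ H]. apply Hodd.
      unfold ev in H. cbn in H. now destruct (Z.even (a + b)). }
  assert (H2 : RtoC 2 * lsum w O = 0).
  { replace (RtoC 2 * lsum w O) with (lsum w O + lsum w O) by ring.
    rewrite HP at 1. ring. }
  destruct (Ceq_dec (lsum w O) 0) as [H0|H0]; [exact H0|].
  exfalso. revert H2. apply Cmult_neq_0; [|exact H0].
  intros H. apply RtoC_inj in H. lra. }
assert (HDnd : NoDup D).
{ apply Injective_map_NoDup; [| apply NoDup_box].
  intros [a b] [c d] H. unfold rotate in H. cbn in H. injection H as H1 H2.
  f_equal; lia. }
assert (HEnd : NoDup E) by apply NoDup_filter, NoDup_box.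
assert (HDE : incl D E).
{ intros p Hp. apply in_map_iff in Hp as [[a b] [<- Hab]].
  apply in_box in Hab. apply filter_In. unfold rotate, ev. cbn [fst snd].
  rewrite in_box. split; [lia|].
  replace (a + b + (a - b))%Z with (2 * a)%Z by ring. apply Z.even_even. }
(* An even point (m, n) is the image of ((m+n)/2, (m-n)/2), and both halves are at most N in
   absolute value when |m| and |n| are. *)
assert (HND : forall p, In p E -> In p (box N) -> In p D).
{ intros [m n] HE HN. apply filter_In in HE as [_ HE]. unfold ev in HE.
  cbn [fst snd] in HE. apply Z.even_spec in HE as [r Hr].
  apply in_box in HN. apply in_map_iff. exists (r, m - r)%Z. split.
  - unfold rotate. cbn [fst snd]. f_equal; lia.
  - apply in_box. lia. }
rewrite (lsum_filter ev w (box (2 * N))), HO.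
fold E. rewrite <- (lsum_map w rotate). fold D.
rewrite (lsum_sub Zpair_dec w D E HDnd HEnd HDE).
set (rest := filter _ E).
change plus with Cplus.
assert (Hcancel : forall x y : C, x + y + 0 - x = y) by (intros; ring).
rewrite Hcancel.
(* [G] is the product majorant of [w]; its sum over a box is the square of the one-dimensional sum
   of [g]. *)
set (G := fun p : Z * Z => (g (fst p) * g (snd p))%R).
assert (HG : forall p, (0 <= G p)%R) by (intros p; apply Rmult_le_pos; apply Hg).
assert (Hsq : forall M, (lsum g (zrange M) * lsum g (zrange M))%R = lsum G (box M)).
{ intros M. symmetry. exact (lsum_prod (K := R_Ring) g g (zrange M) (zrange M)). }
rewrite !Hsq.
assert (Hsub : incl (box N) (box (2 * N))).
{ intros [m n]. rewrite !in_box. lia. }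
rewrite (lsum_sub Zpair_dec G (box N) (box (2 * N)) (NoDup_box _) (NoDup_box _) Hsub).
set (annulus := filter _ (box (2 * N))).
change plus with Rplus.
apply Rle_trans with (lsum G rest); [now apply Cmod_lsum|].
(* By [HND] an even point outside [D] lies outside [box N], so [rest] is contained in the annulus,
   whose [G]-sum is the difference of the two squares. *)
assert (lsum G rest <= lsum G annulus)%R; [|lra].
apply (lsum_le_incl Zpair_dec); [exact HG | now apply NoDup_filter
  | apply NoDup_filter, NoDup_box |].
intros p Hp. apply filter_In in Hp as [HpE Hp]. apply filter_In. split.
- now apply filter_In in HpE.
- destruct (in_dec Zpair_dec p D); [discriminate|].
  destruct (in_dec Zpair_dec p (box N)); [|reflexivity].
  exfalso. auto.
Qed.

(** * Convergence of complex sequences, measured by the real distance to the limit *)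

Definition Ccv (u : nat -> C) (l : C) : Prop :=
  is_lim_seq (fun n => Cmod (u n - l)) 0.

Lemma Ccv_dominated (u : nat -> C) (l : C) (e : nat -> R) :
  (forall n, Cmod (u n - l) <= e n)%R -> is_lim_seq e 0 -> Ccv u l.
Proof.
intros H He. apply is_lim_seq_le_le with (fun _ => 0%R) e.
- intros n. split; [apply Cmod_ge_0 | apply H].
- apply is_lim_seq_const.
- exact He.
Qed.

Lemma Ccv_unique (u : nat -> C) (l l' : C) : Ccv u l -> Ccv u l' -> l = l'.
Proof.
intros H H'.
assert (Hz : Ccv (fun _ => l) l').
{ apply Ccv_dominated with (fun n => Cmod (u n - l) + Cmod (u n - l'))%R.
  - intros n. rewrite <- (Cmod_opp (u n - l)).
    replace (l - l') with (- (u n - l) + (u n - l')) by ring.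
    apply Cmod_triangle.
  - replace (Finite 0) with (Finite (0 + 0)) by (f_equal; ring).
    now apply is_lim_seq_plus'. }
assert (Hc : Cmod (l - l') = 0%R).
{ assert (Hu : Finite (Cmod (l - l')) = Finite 0).
  { rewrite <- (is_lim_seq_unique _ _ Hz). symmetry. apply Lim_seq_const. }
  now injection Hu. }
apply Cmod_eq_0 in Hc. replace l with (l - l' + l') by ring.
rewrite Hc. ring.
Qed.

Lemma Ccv_plus (u v : nat -> C) (l m : C) :
  Ccv u l -> Ccv v m -> Ccv (fun n => u n + v n) (l + m).
Proof.
intros Hu Hv.
apply Ccv_dominated with (fun n => Cmod (u n - l) + Cmod (v n - m))%R.
- intros n. replace (u n + v n - (l + m)) with ((u n - l) + (v n - m)) by ring.
  apply Cmod_triangle.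
- replace (Finite 0) with (Finite (0 + 0)) by (f_equal; ring).
  now apply is_lim_seq_plus'.
Qed.

Lemma Ccv_mult (u v : nat -> C) (l m : C) :
  Ccv u l -> Ccv v m -> Ccv (fun n => u n * v n) (l * m).
Proof.
intros Hu Hv.
apply Ccv_dominated with (fun n => Cmod (u n - l) * Cmod (v n - m)
  + (Cmod (u n - l) * Cmod m + Cmod l * Cmod (v n - m)))%R.
- intros n. rewrite <- !Cmod_mult.
  replace (u n * v n - l * m)
    with ((u n - l) * (v n - m) + ((u n - l) * m + l * (v n - m))) by ring.
  eapply Rle_trans; [apply Cmod_triangle|].
  apply Rplus_le_compat_l, Cmod_triangle.
- replace (Finite 0) with (Finite (0 * 0 + (0 * Cmod m + Cmod l * 0)))
    by (f_equal; ring).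
  repeat apply is_lim_seq_plus'; apply is_lim_seq_mult';
    try apply is_lim_seq_const; assumption.
Qed.

Lemma Ccv_subseq (u : nat -> C) (l : C) (phi : nat -> nat) :
  (forall n, (n <= phi n)%nat) -> Ccv u l -> Ccv (fun n => u (phi n)) l.
Proof.
intros Hphi Hu. apply (is_lim_seq_subseq (fun n => Cmod (u n - l)) 0 phi); [|exact Hu].
intros P [N HN]. exists N. intros n Hn. apply HN. specialize (Hphi n). lia.
Qed.

(** * Series as limits of partial sums, one-sided and bilateral *)

Lemma Ccv_series (u : nat -> C) (b : nat -> R) :
  (forall n, Cmod (u n) <= b n)%R -> ex_series b -> Ccv (sum_n u) (CSeries u).
Proof.
intros Hu Hb.
(* Domination yields a sum, and this sum is then the value that [iota] selects in [CSeries]. *)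
destruct (ex_series_le (V := C_CompleteNormedModule) u b Hu Hb) as [l Hl].
rewrite (CSeries_unique u l Hl).
apply is_lim_seq_spec. intros eps.
destruct (proj1 (filterlim_locally_ball_norm (sum_n u) l) Hl eps) as [N HN].
exists N. intros n Hn. specialize (HN n Hn).
rewrite Rminus_0_r, Rabs_pos_eq by apply Cmod_ge_0. exact HN.
Qed.

(** The negative half starts at -1, so its index stops at [N] when the other half runs to [S N]. *)
Lemma lsum_zrange_S (u : Z -> C) (N : nat) :
  lsum u (zrange (S N)) = sum_n (fun n => u (Z.of_nat n)) (S N)
                          + sum_n (fun n => u (- Z.of_nat (S n))%Z) N.
Proof.
induction N as [|N IH].
- rewrite sum_Sn, !sum_O.
  change (u 1%Z + (u (-1)%Z + (u 0%Z + 0)) = u 0%Z + u 1%Z + u (-1)%Z). ring.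
- rewrite sum_Sn, (sum_Sn (fun n => u (- Z.of_nat (S n))%Z)).
  change (lsum u (zrange (S (S N)))) with
    (u (Z.of_nat (S (S N))) + (u (- Z.of_nat (S (S N)))%Z + lsum u (zrange (S N)))).
  rewrite IH. change plus with Cplus.
  match goal with |- ?x = ?y => change (@eq C x y) end. ring.
Qed.

Lemma Ccv_lsum_zrange (u : Z -> C) (b : nat -> R) :
  (forall t, Cmod (u t) <= b (Z.abs_nat t))%R -> ex_series b ->
  Ccv (fun N => lsum u (zrange (S N))) (CSeriesZ u).
Proof.
intros Hu Hb.
assert (H1 : Ccv (sum_n (fun n => u (Z.of_nat n))) (CSeries (fun n => u (Z.of_nat n)))).
{ apply Ccv_series with b; [|exact Hb]. intros n.
  specialize (Hu (Z.of_nat n)). now rewrite Zabs2Nat.id in Hu. }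
assert (H2 : Ccv (sum_n (fun n => u (- Z.of_nat (S n))%Z))
                 (CSeries (fun n => u (- Z.of_nat (S n))%Z))).
{ apply Ccv_series with (fun n => b (S n)).
  - intros n. specialize (Hu (- Z.of_nat (S n))%Z).
    replace (Z.abs_nat (- Z.of_nat (S n))) with (S n) in Hu by lia. exact Hu.
  - exact (proj1 (ex_series_incr_1 b) Hb). }
apply (Ccv_subseq _ _ S) in H1; [|lia].
pose proof (Ccv_plus _ _ _ _ H1 H2) as H.
eapply is_lim_seq_ext; [|exact H]. intros N. cbn beta.
now rewrite lsum_zrange_S.
Qed.

(** * Terms of the theta series *)

Definition theta_term (a b : C) (t : Z) : C :=
  a ^ Z.to_nat (t * (t + 1) / 2) * b ^ Z.to_nat (t * (t - 1) / 2).

(** The product of two consecutive integers is even and nonnegative. Clearing the division and the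
    truncation lets [lia] and [nia] handle the exponents. *)
Lemma exponent_a (t : Z) :
  (2 * Z.of_nat (Z.to_nat (t * (t + 1) / 2)) = t * (t + 1))%Z.
Proof.
rewrite Z2Nat.id by (apply Z.div_pos; nia).
assert (H : (t * (t + 1) mod 2 = 0)%Z).
{ rewrite Zmod_even, Z.even_mul, Z.even_add. now destruct (Z.even t). }
pose proof (Z.div_mod (t * (t + 1)) 2). lia.
Qed.

Lemma exponent_b (t : Z) :
  (2 * Z.of_nat (Z.to_nat (t * (t - 1) / 2)) = t * (t - 1))%Z.
Proof.
pose proof (exponent_a (t - 1)) as H.
replace ((t - 1) * (t - 1 + 1))%Z with (t * (t - 1))%Z in H by ring. exact H.
Qed.

(** This is (-1)^t, given by parity so that negative t is allowed. *)
Definition Zsign (t : Z) : C := if Z.even t then 1 else - (1).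

Lemma Zsign_add (s t : Z) : Zsign (s + t) = Zsign s * Zsign t.
Proof.
unfold Zsign. rewrite Z.even_add.
destruct (Z.even s), (Z.even t); cbn; ring.
Qed.

Lemma Cpow_opp (x : C) (n : nat) : (- x) ^ n = Zsign (Z.of_nat n) * x ^ n.
Proof.
induction n as [|n IH].
- unfold Zsign. cbn. ring.
- replace (Z.of_nat (S n)) with (1 + Z.of_nat n)%Z by lia.
  rewrite Zsign_add, !Cpow_S, IH. unfold Zsign at 2. cbn. ring.
Qed.

(** The two exponents add up to t^2, which has the parity of t. *)
Lemma theta_term_opp (a b : C) (t : Z) :
  theta_term (- a) (- b) t = Zsign t * theta_term a b t.
Proof.
unfold theta_term. rewrite !Cpow_opp.
pose proof (exponent_a t) as Ha. pose proof (exponent_b t) as Hb.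
set (i := Z.to_nat (t * (t + 1) / 2)) in *.
set (j := Z.to_nat (t * (t - 1) / 2)) in *.
assert (H : Zsign t = Zsign (Z.of_nat i) * Zsign (Z.of_nat j)).
{ rewrite <- Zsign_add.
  replace (Z.of_nat i + Z.of_nat j)%Z with (t * t)%Z by lia.
  unfold Zsign. rewrite Z.even_mul. now destruct (Z.even t). }
rewrite H. ring.
Qed.

(** The exponents of a add up to r(r+1) + s^2 and those of b to r(r-1) + s^2, where s^2 is the sum
    of the two exponents at s. The sign (-1)^(r-s) splits as (-1)^r (-1)^s, one sign for each factor
    on the right. *)
Lemma theta_term_rotate (a b : C) (r s : Z) :
  theta_term a b (r + s) * theta_term (- a) (- b) (r - s)
  = theta_term (- a ^ 2) (- b ^ 2) r * theta_term (- (a * b)) (- (a * b)) s.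
Proof.
rewrite !theta_term_opp.
assert (Hs : Zsign (r - s) = Zsign r * Zsign s).
{ rewrite <- Zsign_add. unfold Zsign. now rewrite Z.even_sub, Z.even_add. }
rewrite Hs. unfold theta_term.
pose proof (exponent_a (r + s)). pose proof (exponent_b (r + s)).
pose proof (exponent_a (r - s)). pose proof (exponent_b (r - s)).
pose proof (exponent_a r). pose proof (exponent_b r).
pose proof (exponent_a s). pose proof (exponent_b s).
set (i1 := Z.to_nat ((r + s) * (r + s + 1) / 2)) in *.
set (j1 := Z.to_nat ((r + s) * (r + s - 1) / 2)) in *.
set (i2 := Z.to_nat ((r - s) * (r - s + 1) / 2)) in *.
set (j2 := Z.to_nat ((r - s) * (r - s - 1) / 2)) in *.
set (i3 := Z.to_nat (r * (r + 1) / 2)) in *.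
set (j3 := Z.to_nat (r * (r - 1) / 2)) in *.
set (i4 := Z.to_nat (s * (s + 1) / 2)) in *.
set (j4 := Z.to_nat (s * (s - 1) / 2)) in *.
assert (Hi : (i1 + i2 = 2 * i3 + (i4 + j4))%nat) by nia.
assert (Hj : (j1 + j2 = 2 * j3 + (i4 + j4))%nat) by nia.
transitivity (Zsign r * Zsign s * (a ^ (i1 + i2) * b ^ (j1 + j2))).
{ rewrite !Cpow_add_r. ring. }
rewrite Hi, Hj, !Cpow_mult_l, !Cpow_add_r, !Cpow_mult_r. ring.
Qed.

(** The exponents add up to t^2, which is at least |t|, and powers of r decrease. This gives a
    geometric majorant. *)
Lemma Cmod_theta_term (a b : C) (r : R) (t : Z) :
  (Cmod a <= r)%R -> (Cmod b <= r)%R -> (r < 1)%R ->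
  (Cmod (theta_term a b t) <= r ^ Z.abs_nat t)%R.
Proof.
intros Ha Hb Hr. unfold theta_term.
pose proof (exponent_a t) as Hi. pose proof (exponent_b t) as Hj.
set (i := Z.to_nat (t * (t + 1) / 2)) in *.
set (j := Z.to_nat (t * (t - 1) / 2)) in *.
pose proof (Cmod_ge_0 a). pose proof (Cmod_ge_0 b).
rewrite Cmod_mult, !Cmod_pow.
apply Rle_trans with (r ^ i * r ^ j)%R.
- apply Rmult_le_compat; try (apply pow_le; assumption); apply pow_incr; lra.
- rewrite <- pow_add.
  assert (Hn : (Z.abs_nat t <= i + j)%nat) by nia.
  replace (i + j)%nat with (Z.abs_nat t + (i + j - Z.abs_nat t))%nat by lia.
  rewrite pow_add.
  assert (0 <= r ^ Z.abs_nat t)%R by (apply pow_le; lra).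
  assert (r ^ (i + j - Z.abs_nat t) <= 1)%R.
  { rewrite <- (pow1 (i + j - Z.abs_nat t)). apply pow_incr. lra. }
  nra.
Qed.

(** * Theta partial sums and the product formula *)

Lemma theta_partial_sums (a b : C) :
  (Cmod a < 1)%R -> (Cmod b < 1)%R ->
  Ccv (fun N => lsum (theta_term a b) (zrange (S N))) (theta a b).
Proof.
intros Ha Hb. pose proof (Cmod_ge_0 a).
apply Ccv_lsum_zrange with (fun n => Rmax (Cmod a) (Cmod b) ^ n)%R.
- intros t. apply Cmod_theta_term;
    [apply Rmax_l | apply Rmax_r | now apply Rmax_lub_lt].
- apply ex_series_geom. rewrite Rabs_pos_eq.
  + now apply Rmax_lub_lt.
  + pose proof (Rmax_l (Cmod a) (Cmod b)). lra.
Qed.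

Lemma lsum_RtoC {A : Type} (g : A -> R) (l : list A) :
  lsum (fun x => RtoC (g x)) l = RtoC (lsum g l).
Proof.
induction l as [|x l IH]; [reflexivity|].
change (RtoC (g x) + lsum (fun x => RtoC (g x)) l = RtoC (g x + lsum g l)).
now rewrite IH, RtoC_plus.
Qed.

(** Both squares run along the same convergent sequence, so their difference vanishes in the limit.
    This difference is the error bound of [lsum_box_rotate]. *)
Lemma zrange_sums_square_gap (r : R) :
  (0 <= r < 1)%R ->
  let A := fun N => lsum (fun t => r ^ Z.abs_nat t)%R (zrange N) in
  is_lim_seq (fun N => A (2 * (1 + N))%nat * A (2 * (1 + N))%nat
                       - A (1 + N)%nat * A (1 + N)%nat)%R 0.
Proof.
intros Hr A.
(* The real sums are embedded in C to reuse the lemmas on [Ccv]. *)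
set (u := fun t : Z => RtoC (r ^ Z.abs_nat t)).
assert (H : Ccv (fun N => lsum u (zrange (1 + N))) (CSeriesZ u)).
{ apply Ccv_lsum_zrange with (fun n => r ^ n)%R.
  - intros t. unfold u. rewrite Cmod_R, Rabs_pos_eq; [lra | now apply pow_le].
  - apply ex_series_geom. rewrite Rabs_pos_eq; lra. }
set (L := CSeriesZ u) in *.
assert (H2 := Ccv_mult _ _ _ _ H H).
assert (H3 : Ccv (fun N => lsum u (zrange (1 + (1 + 2 * N)))
                           * lsum u (zrange (1 + (1 + 2 * N)))) (L * L)).
{ apply (Ccv_subseq _ _ (fun N => 1 + 2 * N)%nat) in H2; [exact H2 | lia]. }
apply is_lim_seq_abs_0.
apply is_lim_seq_le_le with (u := fun _ => 0%R)
  (w := fun N => (Cmod (lsum u (zrange (1 + (1 + 2 * N)))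
                           * lsum u (zrange (1 + (1 + 2 * N))) - L * L)
                  + Cmod (lsum u (zrange (1 + N)) * lsum u (zrange (1 + N)) - L * L))%R).
- intros N. split; [apply Rabs_pos|].
  unfold u. rewrite !lsum_RtoC. unfold A.
  replace (2 * (1 + N))%nat with (1 + (1 + 2 * N))%nat by lia.
  set (x := lsum _ (zrange (1 + (1 + 2 * N)))).
  set (y := lsum _ (zrange (1 + N))).
  rewrite <- Cmod_R, <- (Cmod_opp (y * y - L * L)).
  eapply Rle_trans; [|apply Cmod_triangle]. apply Req_le. f_equal.
  rewrite RtoC_minus, !RtoC_mult. ring.
- apply is_lim_seq_const.
- replace (Finite 0) with (Finite (0 + 0)) by (f_equal; ring).
  now apply is_lim_seq_plus'.
Qed.

(** The left partial products are sums of [w] over [box (2 * N)], the right ones sums of the rotated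
    [w] over [box N]. They differ by at most a gap tending to 0, so the limits agree. *)
Lemma theta_mul_theta_opp (a b : C) :
  (Cmod a < 1)%R -> (Cmod b < 1)%R ->
  theta a b * theta (- a) (- b)
  = theta (- a ^ 2) (- b ^ 2) * theta (- (a * b)) (- (a * b)).
Proof.
intros Ha Hb.
pose proof (Cmod_ge_0 a) as Ha0. pose proof (Cmod_ge_0 b) as Hb0.
assert (Ha' : (Cmod (- a) < 1)%R) by now rewrite Cmod_opp.
assert (Hb' : (Cmod (- b) < 1)%R) by now rewrite Cmod_opp.
assert (Ha2 : (Cmod (- a ^ 2) < 1)%R) by (rewrite Cmod_opp, Cmod_pow; nra).
assert (Hb2 : (Cmod (- b ^ 2) < 1)%R) by (rewrite Cmod_opp, Cmod_pow; nra).
assert (Hab : (Cmod (- (a * b)) < 1)%R) by (rewrite Cmod_opp, Cmod_mult; nra).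
set (r := Rmax (Cmod a) (Cmod b)).
assert (Hr : (0 <= r < 1)%R).
{ split; [|now apply Rmax_lub_lt].
  pose proof (Rmax_l (Cmod a) (Cmod b)). unfold r. lra. }
pose proof (Ccv_mult _ _ _ _ (theta_partial_sums a b Ha Hb)
  (theta_partial_sums _ _ Ha' Hb')) as HL.
pose proof (Ccv_mult _ _ _ _ (theta_partial_sums _ _ Ha2 Hb2)
  (theta_partial_sums _ _ Hab Hab)) as HR.
apply (Ccv_subseq _ _ (fun N => 1 + 2 * N)%nat) in HL; [|lia].
(* It remains to show that the left partial products also converge to the right-hand side. *)
apply (Ccv_unique _ _ _ HL).
set (w := fun p : Z * Z => theta_term a b (fst p) * theta_term (- a) (- b) (snd p)).
set (g := fun t : Z => (r ^ Z.abs_nat t)%R).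
assert (Hg : forall t, (0 <= g t)%R) by (intros t; now apply pow_le).
assert (Hterm : forall t, (Cmod (theta_term a b t) <= g t)%R).
{ intros t. apply Cmod_theta_term; [apply Rmax_l | apply Rmax_r | apply Hr]. }
assert (Hterm' : forall t, (Cmod (theta_term (- a) (- b) t) <= g t)%R).
{ intros t. apply Cmod_theta_term; rewrite ?Cmod_opp;
    [apply Rmax_l | apply Rmax_r | apply Hr]. }
assert (Hw : forall p, (Cmod (w p) <= g (fst p) * g (snd p))%R).
{ intros p. unfold w. rewrite Cmod_mult.
  apply Rmult_le_compat; auto using Cmod_ge_0. }
assert (Hodd : forall m n, Z.even (m + n) = false -> w (n, m) = - w (m, n)).
{ intros m n H. unfold w. cbn [fst snd]. rewrite !theta_term_opp.
  rewrite Z.even_add in H. unfold Zsign.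
  destruct (Z.even m), (Z.even n); try discriminate; ring. }
assert (HB : forall N, lsum w (box N)
  = lsum (theta_term a b) (zrange N) * lsum (theta_term (- a) (- b)) (zrange N)).
{ intros N. exact (lsum_prod (K := C_Ring) _ _ (zrange N) (zrange N)). }
assert (HD : forall N, lsum (fun p => w (rotate p)) (box N)
  = lsum (theta_term (- a ^ 2) (- b ^ 2)) (zrange N)
    * lsum (theta_term (- (a * b)) (- (a * b))) (zrange N)).
{ intros N. etransitivity;
    [|exact (lsum_prod (K := C_Ring) _ _ (zrange N) (zrange N))].
  apply lsum_ext_in. intros [m n] _. apply theta_term_rotate. }
(* The majorant is fixed by the second goal: the gap between the two box sums plus the distance from
   the right partial products to their limit. *)
eapply Ccv_dominated; [|].
2: { replace (Finite 0) with (Finite (0 + 0)) by (f_equal; ring).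
     apply is_lim_seq_plus'; [exact (zrange_sums_square_gap r Hr) | exact HR]. }
intros N. cbn beta.
replace (S (1 + 2 * N)) with (2 * (1 + N))%nat by lia.
replace (S N) with (1 + N)%nat by lia.
rewrite <- HB, <- HD.
pose proof (lsum_box_rotate w g (1 + N) Hg Hw Hodd) as H.
assert (E : forall x y z : C, x - z = (x - y) + (y - z)) by (intros; ring).
rewrite (E _ (lsum (fun p => w (rotate p)) (box (1 + N)))).
eapply Rle_trans; [apply Cmod_triangle|]. now apply Rplus_le_compat_r.
Qed.

(** * Nonvanishing of theta on the diagonal *)

Lemma theta_diag_neq_0_small (x : C) : (Cmod x <= / 4)%R -> theta x x <> 0.
Proof.
intros Hx Hz.
assert (Hx1 : (Cmod x < 1)%R) by lra.
(* The terms at k and -k contribute at most 2/4^k, and the sum of these for k from 1 to N is the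
   stated bound. *)
assert (Hb : forall N, (Cmod (lsum (theta_term x x) (zrange N) - 1)
                        <= 2 / 3 * (1 - (/ 4) ^ N))%R).
{ induction N as [|N IH].
  - assert (E : lsum (theta_term x x) (zrange 0) = RtoC 1).
    { change (theta_term x x 0 + 0 = 1). unfold theta_term. cbn. ring. }
    rewrite E. replace (RtoC 1 - RtoC 1) with (RtoC 0) by ring.
    rewrite Cmod_0. cbn. lra.
  - pose proof (Cmod_theta_term x x (/ 4) (Z.of_nat (S N)) Hx Hx ltac:(lra)) as H1.
    pose proof (Cmod_theta_term x x (/ 4) (- Z.of_nat (S N)) Hx Hx ltac:(lra)) as H2.
    replace (Z.abs_nat (Z.of_nat (S N))) with (S N) in H1 by lia.
    replace (Z.abs_nat (- Z.of_nat (S N))) with (S N) in H2 by lia.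
    change (lsum (theta_term x x) (zrange (S N))) with
      (theta_term x x (Z.of_nat (S N)) + (theta_term x x (- Z.of_nat (S N))
        + lsum (theta_term x x) (zrange N))).
    set (y := theta_term x x (Z.of_nat (S N))) in *.
    set (z := theta_term x x (- Z.of_nat (S N))) in *.
    assert (E : forall c : C, y + (z + c) - 1 = y + (z + (c - 1))) by (intros; ring).
    rewrite E.
    eapply Rle_trans; [apply Cmod_triangle|].
    eapply Rle_trans; [apply Rplus_le_compat_l, Cmod_triangle|].
    cbn [pow] in *. lra. }
pose proof (theta_partial_sums x x Hx1 Hx1) as H. rewrite Hz in H.
(* With limit 0, some partial sum has modulus below 1/3; being within less than 2/3 of 1, it
   contradicts the triangle inequality for 1. *)
apply is_lim_seq_spec in H. destruct (H (mkposreal (/ 3) ltac:(lra))) as [N HN].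
specialize (HN N (le_n N)). cbn [pos] in HN.
rewrite Rminus_0_r, Rabs_pos_eq in HN by apply Cmod_ge_0.
specialize (Hb (S N)). set (s := lsum _ _) in *.
assert (Hp : (0 < (/ 4) ^ S N)%R) by (apply pow_lt; lra).
assert (E : forall c : C, RtoC 1 = (c - 0) + - (c - 1)) by (intros; ring).
pose proof (Cmod_triangle (s - 0) (- (s - 1))) as Ht.
rewrite <- (E s), Cmod_opp, Cmod_1 in Ht. lra.
Qed.

(* phi(x) phi(-x) = phi(-x^2)^2, so a zero at -x propagates to -x^2, -x^4, ...,
   and hence to a neighbourhood of 0, where phi is close to 1. *)
Lemma theta_diag_neq_0 (x : C) : (Cmod x < 1)%R -> theta (- x) (- x) <> 0.
Proof.
intros Hx.
(* Here k counts the squarings that bring y into the disc of radius 1/4. *)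
assert (Hk : forall k y, (Cmod y < 1)%R -> (Cmod y ^ (2 ^ k) <= / 4)%R ->
             theta (- y) (- y) <> 0).
{ induction k as [|k IH]; intros y Hy H4.
  - apply theta_diag_neq_0_small. rewrite Cmod_opp. cbn in H4. lra.
  - intros Hz. pose proof (theta_mul_theta_opp y y Hy Hy) as Hid.
    replace (y * y) with (y ^ 2) in Hid by ring.
    rewrite Hz, Cmult_0_r in Hid. symmetry in Hid. revert Hid.
    assert (Hn : theta (- y ^ 2) (- y ^ 2) <> 0).
    { apply IH; rewrite Cmod_pow.
      - pose proof (Cmod_ge_0 y). nra.
      - rewrite <- pow_mult. exact H4. }
    now apply Cmult_neq_0. }
destruct (pow_lt_1_zero (Cmod x)) with (y := (/ 4)%R) as [N HN].
- rewrite Rabs_pos_eq; [exact Hx | apply Cmod_ge_0].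
- lra.
- apply (Hk N x Hx).
  assert (Hge : (2 ^ N >= N)%nat) by (pose proof (Nat.pow_gt_lin_r 2 N); lia).
  specialize (HN _ Hge). apply Rabs_def2 in HN. lra.
Qed.

(** * Quotients of theta values *)

Lemma Cinv_0 : / RtoC 0 = RtoC 0.
(* Both coordinates have numerator 0, so the value is 0 whatever the real inverse of 0 is. *)
Proof. unfold Cinv, RtoC. cbn. f_equal; unfold Rdiv; ring. Qed.

Lemma Cinv_mult (x y : C) : / (x * y) = / x * / y.
Proof.
destruct (Ceq_dec x 0) as [->|Hx]; [now rewrite Cmult_0_l, Cinv_0, Cmult_0_l|].
destruct (Ceq_dec y 0) as [->|Hy]; [now rewrite Cmult_0_r, Cinv_0, Cmult_0_r|].
now field.
Qed.

(* Where a denominator vanishes ([/ 0 = 0]), so does the other side's, by the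
   product formula. *)
Lemma theta_quotient_mul (a b c d : C) :
  (Cmod a < 1)%R -> (Cmod b < 1)%R -> (Cmod c < 1)%R -> (Cmod d < 1)%R ->
  a * b = c * d ->
  theta a b / theta c d * (theta (- a) (- b) / theta (- c) (- d))
  = theta (- a ^ 2) (- b ^ 2) / theta (- c ^ 2) (- d ^ 2).
Proof.
intros Ha Hb Hc Hd E.
assert (Hp : theta (- (a * b)) (- (a * b)) <> 0).
{ apply theta_diag_neq_0. rewrite Cmod_mult.
  pose proof (Cmod_ge_0 a). pose proof (Cmod_ge_0 b). nra. }
transitivity ((theta a b * theta (- a) (- b)) / (theta c d * theta (- c) (- d))).
{ unfold Cdiv. rewrite Cinv_mult. ring. }
rewrite !theta_mul_theta_opp, <- E by assumption.
unfold Cdiv. rewrite Cinv_mult.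
set (p := theta (- (a * b)) (- (a * b))) in *.
transitivity (theta (- a ^ 2) (- b ^ 2) * / theta (- c ^ 2) (- d ^ 2) * (p * / p)).
- ring.
- rewrite Cinv_r by exact Hp. ring.
Qed.

(** For odd exponents, replacing q by -q negates every argument of theta, so this is
    [theta_quotient_mul] with a = -q^i, b = -q^j, c = -q^k, d = -q^l. The condition on exponent sums
    gives ab = cd. *)
Lemma theta_quotient_pow (q : C) (i j k l : nat) :
  (Cmod q < 1)%R ->
  Nat.odd i = true -> Nat.odd j = true -> Nat.odd k = true -> Nat.odd l = true ->
  (i + j = k + l)%nat ->
  theta (- q ^ i) (- q ^ j) / theta (- q ^ k) (- q ^ l)
  * (theta (- (- q) ^ i) (- (- q) ^ j) / theta (- (- q) ^ k) (- (- q) ^ l))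
  = theta (- (q ^ 2) ^ i) (- (q ^ 2) ^ j) / theta (- (q ^ 2) ^ k) (- (q ^ 2) ^ l).
Proof.
intros Hq Hi Hj Hk Hl E.
(* Oddness excludes the exponent 0, for which the modulus would be 1. *)
assert (Hm : forall n, Nat.odd n = true -> (Cmod (- q ^ n) < 1)%R).
{ intros n Hn. rewrite Cmod_opp, Cmod_pow. destruct n as [|n]; [discriminate|].
  assert (H : (Cmod q ^ n <= 1)%R).
  { rewrite <- (pow1 n). apply pow_incr. split; [apply Cmod_ge_0 | lra]. }
  pose proof (Cmod_ge_0 q). cbn [pow]. nra. }
assert (Ho : forall n, Nat.odd n = true -> - (- q) ^ n = - - q ^ n).
{ intros n Hn. rewrite Cpow_opp. unfold Zsign.
  replace (Z.even (Z.of_nat n)) with false; [ring|].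
  rewrite <- Nat.negb_even in Hn. destruct (Nat.even n) eqn:En; [discriminate|].
  destruct (Z.even (Z.of_nat n)) eqn:EZ; [|reflexivity].
  apply Z.even_spec in EZ as [m Hm']. exfalso.
  assert (Nat.even n = true) by (apply Nat.even_spec; exists (Z.to_nat m); lia).
  congruence. }
assert (H2 : forall n, - (q ^ 2) ^ n = - (- q ^ n) ^ 2).
{ intros n. rewrite <- Cpow_mult_r, Nat.mul_comm, Cpow_mult_r. ring. }
rewrite !Ho, !H2 by assumption.
apply theta_quotient_mul; auto.
transitivity (q ^ (i + j)); [|rewrite E]; rewrite Cpow_add_r; ring.
Qed.

(** * The functions V1, V2 and V3 *)

Lemma V1_mul_opp (q : C) : (Cmod q < 1)%R -> V1 q * V1 (- q) = - V1 (q ^ 2).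
Proof.
intros Hq.
pose proof (theta_quotient_pow q 1 27 13 15 Hq eq_refl eq_refl eq_refl eq_refl eq_refl)
  as H.
(* [V1] has a bare q where the general formula has q^1. The sign comes from the prefactor: q^3
   (-q)^3 = -(q^2)^3, and likewise q (-q) = -q^2 for [V3], whereas q^2 (-q)^2 = (q^2)^2 for [V2]. *)
rewrite !Cpow_1_r in H. unfold V1. rewrite <- H. ring.
Qed.

Lemma V2_mul_opp (q : C) : (Cmod q < 1)%R -> V2 q * V2 (- q) = V2 (q ^ 2).
Proof.
intros Hq. unfold V2.
rewrite <- (theta_quotient_pow q 3 25 11 17) by (reflexivity || assumption). ring.
Qed.

Lemma V3_mul_opp (q : C) : (Cmod q < 1)%R -> V3 q * V3 (- q) = - V3 (q ^ 2).
Proof.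
intros Hq. unfold V3.
rewrite <- (theta_quotient_pow q 5 23 9 19) by (reflexivity || assumption). ring.
Qed.

Lemma Cpow_opp_mod2 (x : C) (n : nat) :
  ((n mod 2 = 0)%nat -> (- x) ^ n = x ^ n) /\
  ((n mod 2 = 1)%nat -> (- x) ^ n = - (x ^ n)).
Proof.
rewrite Cpow_opp. unfold Zsign.
split; intros Hn; pose proof (Nat.div_mod_eq n 2) as E; rewrite Hn in E;
  replace (Z.of_nat n) with (Z.of_nat (n mod 2) + 2 * Z.of_nat (n / 2))%Z by lia;
  rewrite Z.even_add, Z.even_even, Hn; cbn; ring.
Qed.

Theorem theorem2p3 (q : C) (hq : (Cmod q < 1)%R) (n : nat) (hn : (0 < n)%nat) :
  (((n mod 2 = 0)%nat -> V1 q ^ n * V1 (- q) ^ n = V1 (q ^ 2) ^ n) /\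
   ((n mod 2 = 1)%nat -> V1 q ^ n * V1 (- q) ^ n = - (V1 (q ^ 2) ^ n))) /\
  V2 q ^ n * V2 (- q) ^ n = V2 (q ^ 2) ^ n /\
  (((n mod 2 = 0)%nat -> V3 q ^ n * V3 (- q) ^ n = V3 (q ^ 2) ^ n) /\
   ((n mod 2 = 1)%nat -> V3 q ^ n * V3 (- q) ^ n = - (V3 (q ^ 2) ^ n))).
Proof.
(* Gathering the n-th powers reduces everything to the case n = 1; only the sign (-1)^n then depends
   on parity. *)
rewrite <- !Cpow_mult_l, V1_mul_opp, V2_mul_opp, V3_mul_opp by exact hq.
split; [apply Cpow_opp_mod2 | split; [reflexivity | apply Cpow_opp_mod2]].
Qed.
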